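(* Let $\Omega:\Delta^C\to\mathbb R$ be convex with $\Omega^*$ differentiable on $\mathbb R^C$, and let $\mathcal L_\Omega$ be the associated Fenchel–Young loss. If its prediction mapping $\hat p(s)=\nabla\Omega^*(s)$ is weakly order preserving, then $\mathcal L_\Omega$ is Top-$k$ calibrated (for every $1\le k\le C$) and DCG-consistent.
   Context: $\Delta^C=\{p\in\mathbb R^C: p_i\ge 0,\ \sum_i p_i=1\}$. $\Omega^*(s)=\sup_{p\in\Delta^C}\{\langle s,p\rangle-\Omega(p)\}$ for $s\in\mathbb R^C$. The Fenchel–Young loss is $\mathcal L_\Omega(y,s)=\Omega^*(s)+\Omega(y)-\langle s,y\rangle$ for a one-hot label vector $y$ and $s\in\mathbb R^C$. A mapping $\hat p:\mathbb R^C\to\Delta^C$ is weakly order preserving (WOP) if for all $i\neq j$ and all $s$: $s_i>s_j\Rightarrow\hat p_i(s)\ge\hat p_j(s)$, and moreover there exist $s$ and $i\ne j$ with $s_i>s_j$ and $\hat p_i(s)=\hat p_j(s)$. For $p\in\Delta^C$, the conditional risk of $s$ is $\mathbb E_{y\sim p}[\mathcal L_\Omega(y,s)]$, where $y=e_i$ (the $i$-th standard basis vector) with probability $p_i$. For $v\in\mathbb R^C$, $\operatorname{Top}_k(v)$ denotes a set of $k$ indices of largest components of $v$ (ties broken arbitrarily). Top-$k$ calibrated: for every $p\in\Delta^C$ and every minimizer $s^*\in\mathbb R^C$ of the conditional risk, $\operatorname{Top}_k(s^* )$ (under any tie-breaking) is Bayes-optimal for the top-$k$ error, i.e. it minimizes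 over $k$-element sets $A\subseteq\{1,\dots,C\}$ the probability $\mathbb P_{i\sim p}(i\notin A)$. DCG-consistent: for every $p\in\Delta^C$ and every minimizer $s^*$ of the conditional risk, every permutation $\pi$ sorting $s^*$ in non-increasing order maximizes the expected DCG, $\sum_{i=1}^C \frac{p_{\pi(i)}}{\log_2(i+1)}$, over all permutations of $\{1,\dots,C\}$. *)

(* Defs.v *)
From HB Require Import structures.
From mathcomp Require Export all_boot all_order all_algebra all_fingroup.
From mathcomp Require Export all_classical all_reals all_analysis.

Set Implicit Arguments.
Unset Strict Implicit.
Unset Printing Implicit Defensive.

Import Order.TTheory GRing.Theory Num.Theory.
Import numFieldNormedType.Exports.

Local Open Scope classical_set_scope.
Local Open Scope ring_scope.

Section Defs.
Context {R : realType} {C : nat}.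

Definition dot (u v : 'rV[R]_C) : R := \sum_i u 0 i * v 0 i.

Definition onehot (i : 'I_C) : 'rV[R]_C := delta_mx 0 i.

Definition simplex : set 'rV[R]_C :=
  [set p | (forall i, 0 <= p 0 i) /\ \sum_i p 0 i = 1].

(* Regularizers are total functions on 'rV[R]_C, but only their values on the
   simplex are ever used.  The real-valued [sup] is harmless: a convex function
   on the simplex is bounded below, so for 0 < C the set is nonempty and bounded
   above. *)
Definition fconj (Omega : 'rV[R]_C -> R) (s : 'rV[R]_C) : R :=
  sup [set dot s p - Omega p | p in simplex].

Definition fenchel_young (Omega : 'rV[R]_C -> R) (y s : 'rV[R]_C) : R :=
  fconj Omega s + Omega y - dot s y.

Definition grad (f : 'rV[R]_C -> R) (s : 'rV[R]_C) : 'rV[R]_C :=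
  \row_i 'D_(onehot i) f s.

Definition weakly_order_preserving (phat : 'rV[R]_C -> 'rV[R]_C) : Prop :=
  [/\ forall s, simplex (phat s),
      forall (i j : 'I_C) (s : 'rV[R]_C), i != j ->
        s 0 j < s 0 i -> phat s 0 j <= phat s 0 i
    & exists (s : 'rV[R]_C) (i j : 'I_C),
        [/\ i != j, s 0 j < s 0 i & phat s 0 i = phat s 0 j]].

Definition cond_risk (L : 'rV[R]_C -> 'rV[R]_C -> R) (p s : 'rV[R]_C) : R :=
  \sum_i p 0 i * L (onehot i) s.

Definition risk_minimizer (L : 'rV[R]_C -> 'rV[R]_C -> R)
    (p sstar : 'rV[R]_C) : Prop :=
  forall s, cond_risk L p sstar <= cond_risk L p s.

(* [is_top k v A]: A is a possible value of Top_k(v), for some tie-breaking. *)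
Definition is_top (k : nat) (v : 'rV[R]_C) (A : {set 'I_C}) : Prop :=
  #|A| = k /\ forall i j, i \in A -> j \notin A -> v 0 j <= v 0 i.

Definition top_error (p : 'rV[R]_C) (A : {set 'I_C}) : R :=
  \sum_(i | i \notin A) p 0 i.

Definition topk_calibrated (k : nat) (L : 'rV[R]_C -> 'rV[R]_C -> R) : Prop :=
  forall p sstar, simplex p -> risk_minimizer L p sstar ->
  forall A, is_top k sstar A ->
  forall B : {set 'I_C}, #|B| = k -> top_error p A <= top_error p B.

Definition log2 (x : R) : R := ln x / ln 2.

(* Ranks are 0-based here, hence the discount log2 (i + 2). *)
Definition dcg (p : 'rV[R]_C) (pi : 'S_C) : R :=
  \sum_(i < C) p 0 (pi i) / log2 i.+2%:R.

Definition sorts (s : 'rV[R]_C) (pi : 'S_C) : Prop :=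
  forall i j : 'I_C, (i <= j)%N -> s 0 (pi j) <= s 0 (pi i).

Definition dcg_consistent (L : 'rV[R]_C -> 'rV[R]_C -> R) : Prop :=
  forall p sstar, simplex p -> risk_minimizer L p sstar ->
  forall pi : 'S_C, sorts sstar pi ->
  forall tau : 'S_C, dcg p tau <= dcg p pi.

End Defs.

(* Main.v *)
Require Import Defs.

Set Implicit Arguments.
Unset Strict Implicit.
Unset Printing Implicit Defensive.

Import Order.TTheory GRing.Theory Num.Theory.
Import numFieldNormedType.Exports.

Local Open Scope classical_set_scope.
Local Open Scope ring_scope.

(** First-order optimality of the conditional risk gives [p = grad Omega* (s)],
    so everything reduces to showing that [s_j <= s_i] implies [p_j <= p_i].
    Order preservation covers [s_j < s_i].  On a tie, the derivative of
    [t |-> Omega*(s + t (e_i - e_j))] is [>= 0] for [t > 0] and [<= 0] for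
    [t < 0], so [t = 0] is a minimum and [p_i = p_j].  Top-k optimality is then an
    exchange argument, and DCG optimality follows from it by Abel summation:
    the DCG is a nonnegative combination of the masses of the top-k sets. *)

(** The two difference quotients are the same function, so Fermat's rule and the mean value theorem
    in one variable become available for [f] along a line. *)
Lemma is_derive_line (R : realType) (V : normedModType R) (f : V -> R)
    (s v : V) (t : R) :
  differentiable f (s + t *: v) ->
  is_derive t 1 (fun h : R => f (s + h *: v)) ('D_v f (s + t *: v)).
Proof.
move=> df; have := diff_derivable (v := v) df; rewrite /derivable => cv.
have quotE : (fun h : R => h^-1 *: (((fun h : R => f (s + h *: v)) \o shift t)
                 (h *: 1) - f (s + t *: v)))
           = (fun h : R => h^-1 *: ((f \o shift (s + t *: v)) (h *: v)
                 - f (s + t *: v))).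
  apply/funext => h /=; congr (_ *: (f _ - _)).
  by rewrite [h *: 1]mulr1 scalerDl addrCA.
by split; rewrite /derivable /derive quotE.
Qed.

Lemma derive_min_eq0 (R : realType) (V : normedModType R) (f : V -> R)
    (s v : V) :
  (forall x, differentiable f x) ->
  (forall t : R, f s <= f (s + t *: v)) -> 'D_v f s = 0.
Proof.
move=> df fmin.
have dline t := is_derive_line (df (s + t *: v)).
have : is_derive (0 : R) 1 (fun h : R => f (s + h *: v)) 0.
  (* Any open interval around 0 would do, since the minimum is global on the line. *)
  apply: (@derive1_at_min _ _ (-1) 1); rewrite ?in_itv /= ?ltrN10 ?ltr01 //.
  by move=> t _; rewrite scale0r addr0.
move=> [_ <-]; have [_ ->] := dline 0.
by rewrite scale0r addr0.
Qed.

(** By the mean value theorem, the increment from 0 to [t] is [t] times a slope taken strictly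
    between them. The slope never has the sign opposite to [t], so the increment is nonnegative. *)
Lemma derive_line_min (R : realType) (V : normedModType R) (f : V -> R)
    (s v : V) :
  (forall x, differentiable f x) ->
  (forall t : R, 0 < t -> 0 <= 'D_v f (s + t *: v)) ->
  (forall t : R, t < 0 -> 'D_v f (s + t *: v) <= 0) ->
  forall t : R, f s <= f (s + t *: v).
Proof.
move=> df dpos dneg t.
have dline u := is_derive_line (df (s + u *: v)).
have cont (a b : R) : {within `[a, b], continuous (fun h : R => f (s + h *: v))}.
  by apply: derivable_within_continuous => u _; have [] := dline u.
have f0 : f s = f (s + 0 *: v) by rewrite scale0r addr0.
rewrite f0; have [t0|t0|->//] := ltgtP t 0.
- have [c] := MVT t0 (fun x _ => dline x) (cont _ _).
  rewrite in_itv /= => /andP[_ c0] E; rewrite -subr_le0 E.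
  by rewrite mulr_le0_ge0 ?dneg // sub0r oppr_ge0 ltW.
- have [c] := MVT t0 (fun x _ => dline x) (cont _ _).
  rewrite in_itv /= => /andP[c0 _] E; rewrite -subr_ge0 E.
  by rewrite mulr_ge0 ?dpos // subr0 ltW.
Qed.

Lemma deriveB_dir (R : realType) (V : normedModType R) (f : V -> R)
    (s u v : V) :
  differentiable f s -> 'D_(u - v) f s = 'D_u f s - 'D_v f s.
Proof. by move=> df; rewrite !deriveE // linearB. Qed.

Lemma grad_tie (R : realType) (C : nat) (f : 'rV[R]_C -> R)
    (s : 'rV[R]_C) (i j : 'I_C) :
  (forall x, differentiable f x) ->
  (forall (i j : 'I_C) (s : 'rV[R]_C), i != j ->
     s 0 j < s 0 i -> grad f s 0 j <= grad f s 0 i) ->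
  s 0 i = s 0 j -> grad f s 0 i = grad f s 0 j.
Proof.
move=> df mono sij; have [->//|nij] := eqVneq i j.
pose v : 'rV[R]_C := onehot i - onehot j.
have nji : (j == i) = false by rewrite eq_sym (negbTE nij).
have vi t : (s + t *: v) 0 i = s 0 j + t.
  by rewrite !mxE !eqxx (negbTE nij) /= subr0 mulr1 sij.
have vj t : (s + t *: v) 0 j = s 0 j - t.
  by rewrite !mxE !eqxx nji /= sub0r mulrN1.
(* The difference of the two gradient entries is the derivative along [v], to which Fermat's rule
   applies. *)
apply/eqP; rewrite -subr_eq0 !mxE -deriveB_dir //; apply/eqP.
apply: derive_min_eq0 => // t; apply: derive_line_min => // {}t t0.
- rewrite deriveB_dir // subr_ge0.
  have := mono i j (s + t *: v) nij; rewrite vi vj !mxE; apply.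
  by rewrite ltrD2l (lt_trans _ t0) // oppr_lt0.
- rewrite deriveB_dir // subr_le0.
  have := mono j i (s + t *: v); rewrite vi vj nji !mxE; apply => //.
  by rewrite ltrD2l (lt_trans t0) // oppr_gt0.
Qed.

Lemma grad_le (R : realType) (C : nat) (f : 'rV[R]_C -> R)
    (s : 'rV[R]_C) (i j : 'I_C) :
  (forall x, differentiable f x) ->
  (forall (i j : 'I_C) (s : 'rV[R]_C), i != j ->
     s 0 j < s 0 i -> grad f s 0 j <= grad f s 0 i) ->
  s 0 j <= s 0 i -> grad f s 0 j <= grad f s 0 i.
Proof.
move=> df mono; rewrite le_eqVlt => /predU1P[sji|sji].
  by rewrite (grad_tie df mono (esym sji)).
by apply: mono => //; apply: contraTneq sji => ->; rewrite ltxx.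
Qed.

Lemma dotDl (R : realType) (C : nat) (s t p : 'rV[R]_C) :
  dot (s + t) p = dot s p + dot t p.
Proof. by rewrite -big_split /=; apply: eq_bigr => i _; rewrite mxE mulrDl. Qed.

Lemma dotZl (R : realType) (C : nat) (a : R) (s p : 'rV[R]_C) :
  dot (a *: s) p = a * dot s p.
Proof. by rewrite mulr_sumr; apply: eq_bigr => i _; rewrite mxE mulrA. Qed.

Lemma dot_onehotr (R : realType) (C : nat) (s : 'rV[R]_C) (i : 'I_C) :
  dot s (onehot i) = s 0 i.
Proof.
rewrite /dot (bigD1 i) //= big1 => [|j nji]; rewrite !mxE ?eqxx ?mulr1 ?addr0 //.
by rewrite (negbTE nji) mulr0.
Qed.

Lemma dot_onehotl (R : realType) (C : nat) (p : 'rV[R]_C) (i : 'I_C) :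
  dot (onehot i) p = p 0 i.
Proof.
by rewrite -[RHS]dot_onehotr; apply: eq_bigr => j _; rewrite mulrC.
Qed.

(** The weights sum to 1, so averaging leaves [fconj Omega s] intact. The last sum is free of [s]
    and cancels whenever two risks are compared. *)
Lemma cond_risk_fenchel_young (R : realType) (C : nat)
    (Omega : 'rV[R]_C -> R) (p s : 'rV[R]_C) : simplex p ->
  cond_risk (fenchel_young Omega) p s =
  fconj Omega s - dot s p + \sum_i p 0 i * Omega (onehot i).
Proof.
move=> [_ p1]; rewrite /cond_risk /fenchel_young.
under eq_bigr => i _ do rewrite dot_onehotr -addrA mulrDr mulrBr [p 0 i * s 0 i]mulrC.
rewrite big_split /= sumrB -mulr_suml p1 mul1r -/(dot s p).
by rewrite addrCA addrC -!addrA; congr (_ + _); rewrite addrC.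
Qed.

Lemma risk_minimizer_grad (R : realType) (C : nat) (Omega : 'rV[R]_C -> R)
    (p s : 'rV[R]_C) :
  (forall x, differentiable (fconj Omega) x) -> simplex p ->
  risk_minimizer (fenchel_young Omega) p s -> grad (fconj Omega) s = p.
Proof.
move=> df hp smin; apply/rowP => i; rewrite mxE.
have dline t := is_derive_line (v := onehot i) (df (s + t *: onehot i)).
(* Up to terms constant in [h], this is the conditional risk along the [i]-th axis. *)
pose g (h : R) := fconj Omega (s + h *: onehot i) - h * p 0 i.
have dg (t : R) : is_derive t 1 g ('D_(onehot i) (fconj Omega) (s + t *: onehot i) - p 0 i).
  have -> : g = (fun h : R => fconj Omega (s + h *: onehot i)) - p 0 i \*: id.
    by apply/funext => h; rewrite /g !fctE [h * _]mulrC.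
  apply: is_deriveB.
  by apply: is_derive_eq; rewrite [_ *: _]mulr1.
have : is_derive (0 : R) 1 g 0.
  apply: (@derive1_at_min _ _ (-1) 1); rewrite ?in_itv /= ?ltrN10 ?ltr01 //.
  move=> t _; have := smin (s + t *: onehot i).
  rewrite !cond_risk_fenchel_young // lerD2r dotDl dotZl dot_onehotl.
  rewrite /g scale0r addr0 mul0r subr0 opprD addrA.
  by rewrite [X in _ <= X]addrAC lerD2r.
move=> [_]; have [_ ->] := dg 0.
by rewrite scale0r addr0 => /eqP; rewrite subr_eq0 => /eqP.
Qed.

(** The common part of [A] and [B] cancels. The two differences have equal size, and every value on
    [A :\: B] dominates every value on [B :\: A]. *)
Lemma sum_le_exchange (R : realType) (T : finType) (q : T -> R)
    (A B : {set T}) : #|A| = #|B| ->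
  (forall i j, i \in A -> j \notin A -> q j <= q i) ->
  \sum_(i in B) q i <= \sum_(i in A) q i.
Proof.
move=> cAB top.
have cD : #|A :\: B| = #|B :\: A|.
  by apply/eqP; rewrite -(eqn_add2l #|A :&: B|) cardsID finset.setIC cardsID cAB.
rewrite (big_setID A) [leRHS](big_setID B) /= finset.setIC lerD2l.
have [AB0|] := eqVneq (A :\: B) finset.set0.
  have BA0 : B :\: A = finset.set0 by apply/eqP; rewrite -cards_eq0 -cD AB0 cards0.
  by rewrite AB0 BA0 !big_set0.
rewrite -card_gt0 => m0.
(* Scaling by the common positive cardinality turns both sides into double sums over pairs, which
   are compared term by term without choosing a bijection. *)
rewrite -(ler_pM2l (x := #|A :\: B|%:R)) ?ltr0n // [X in _ <= X%:R * _]cD.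
rewrite !mulr_natl -!sumr_const [leRHS]exchange_big /=.
by apply: ler_sum => i /setDP[iA _]; apply: ler_sum => j /setDP[_ jA]; exact: top.
Qed.

Lemma top_error_le (R : realType) (C : nat) (p : 'rV[R]_C) (A B : {set 'I_C}) :
  #|A| = #|B| -> (forall i j, i \in A -> j \notin A -> p 0 j <= p 0 i) ->
  top_error p A <= top_error p B.
Proof.
move=> cAB top; have := sum_le_exchange cAB top.
have mass (D : {set 'I_C}) : \sum_(i in D) p 0 i = \sum_i p 0 i - top_error p D.
  by rewrite [\sum_i _](bigID (mem D)) /= addrK.
by rewrite !mass lerD2l lerN2.
Qed.

(** Each [w i] is [w n] plus the decrements from [i] on; exchanging the sums collects prefix sums of
    [q]. The boundary value [w n] lies one past the last index, hence [w] is defined on [nat]. *)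
Lemma sum_by_parts (R : realType) (n : nat) (q : 'I_n -> R) (w : nat -> R) :
  \sum_i q i * w i =
  w n * \sum_i q i + \sum_(k < n) (w k - w k.+1) * \sum_(i < n | (i <= k)%N) q i.
Proof.
have tel (i : 'I_n) : w i = w n + \sum_(k < n | (i <= k)%N) (w k - w k.+1).
  rewrite -(big_mkord (fun k => (i <= k)%N) (fun k => w k - w k.+1)).
  (* Indices below [i] contribute nothing because of the filter; the rest telescopes to
     [w i - w n]. *)
  rewrite (big_cat_nat (leq0n i) (ltnW (ltn_ord i))) /= big_nat_cond big1 => [|k].
    rewrite add0r big_nat_cond.
    rewrite (eq_bigl (fun k => (i <= k < n)%N && true)) => [|k]; last first.
      by case: (i <= k)%N; rewrite ?andbF ?andbT.
    rewrite -big_nat_cond (telescope_sumr_eq (fun k => - w k)) ?opprK ?addrA.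
    + by rewrite subrr add0r.
    + exact: ltnW.
    + by move=> k _; rewrite opprK addrC.
  by move=> /andP[/andP[_ ki]]; rewrite leqNgt ki.
under eq_bigr => i _ do rewrite [w i]tel mulrDr [_ * w n]mulrC mulr_sumr.
rewrite big_split /= -mulr_sumr; congr (_ + _).
rewrite (exchange_big_dep xpredT) //=; apply: eq_bigr => k _.
by rewrite mulr_sumr; apply: eq_bigr => i _; rewrite mulrC.
Qed.

Lemma dcg_sorted_max (R : realType) (C : nat) (p : 'rV[R]_C) (pi tau : 'S_C) :
  sorts p pi -> dcg p tau <= dcg p pi.
Proof.
move=> srt; pose w k : R := (log2 k.+2%:R)^-1.
have log2_gt0 k : 0 < log2 (k.+2%:R : R).
  by rewrite divr_gt0 ?ln_gt0 ?ltr1n.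
have w_le k : w k.+1 <= w k.
  rewrite lef_pV2 ?posrE // ler_pM2r ?invr_gt0 ?ln_gt0 ?ltr1n //.
  by rewrite ler_ln ?posrE ?ltr0n // ler_nat.
rewrite /dcg (sum_by_parts (fun i => p 0 (tau i)) w).
rewrite (sum_by_parts (fun i => p 0 (pi i)) w).
have total (s : 'S_C) : \sum_i p 0 (s i) = \sum_i p 0 i.
  by rewrite [RHS](reindex_inj (@perm_inj _ s)).
(* The boundary terms agree because the total mass is invariant under permutation. The other
   coefficients are nonnegative since the discounts decrease, so prefix masses can be compared for
   each [k] separately. *)
rewrite !total lerD2l; apply: ler_sum => k _.
rewrite ler_wpM2l ?subr_ge0 //.
pose I : {set 'I_C} := [set i : 'I_C | (i <= k)%N]%SET.
have prefix (s : 'S_C) :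
    \sum_(i < C | (i <= k)%N) p 0 (s i) = \sum_(x in [set s i | i in I]%SET) p 0 x.
  rewrite big_imset /=; last by move=> x y _ _; exact: perm_inj.
  by apply: eq_bigl => i; rewrite inE.
rewrite !prefix; apply: sum_le_exchange.
  by rewrite !card_imset //; exact: perm_inj.
(* An item outside the image of [I] has rank above [k] under [pi], hence comes after the item of
   rank [a]. *)
move=> _ j /imsetP[a + ->]; rewrite inE => ak jI.
rewrite -(permKV pi j); apply: srt.
apply: (leq_trans ak); rewrite leqNgt; apply: contra jI => lt.
by apply/imsetP; exists (pi^-1 j)%g; rewrite ?permKV // inE ltnW.
Qed.

Theorem theorem3p6 (R : realType) (C : nat) (Omega : 'rV[R]_C -> R)
    (Omega_convex : convex_function (simplex : set 'rV[R]_C) Omega)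
    (conj_differentiable : forall s : 'rV[R]_C, differentiable (fconj Omega) s)
    (grad_wop : weakly_order_preserving (grad (fconj Omega))) :
  (forall k : nat, (1 <= k <= C)%N -> topk_calibrated k (fenchel_young Omega))
  /\ dcg_consistent (fenchel_young Omega).
Proof.
have [_ mono _] := grad_wop.
have p_le (p s : 'rV[R]_C) i j : simplex p ->
    risk_minimizer (fenchel_young Omega) p s -> s 0 j <= s 0 i -> p 0 j <= p 0 i.
  move=> hp hs; rewrite -(risk_minimizer_grad conj_differentiable hp hs).
  exact: grad_le.
split=> [k _ p s hp hs A [cA top] B cB|p s hp hs pi srt tau].
(* By [p_le], a top set of the minimizer [s] is a top set of [p], and below, a permutation sorting
   [s] also sorts [p], however ties are broken. *)
- apply: top_error_le => [|i j iA jA]; first by rewrite cA cB.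
  by apply: (p_le p s) => //; exact: top.
- by apply: dcg_sorted_max => i j ij; apply: (p_le p s) => //; exact: srt.
Qed.
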